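(* The monoid $M_2(\mathbb{Z}_{\max})$ is minimally generated by the four matrices $$A = \begin{pmatrix} 1 & -\infty \\ -\infty & 0 \end{pmatrix},\quad B = \begin{pmatrix} -\infty & -1 \\ 0 & -\infty \end{pmatrix},\quad C = \begin{pmatrix} -\infty & -\infty \\ -\infty & 0 \end{pmatrix},\quad D = \begin{pmatrix} 0 & 0 \\ -\infty & 0 \end{pmatrix}.$$
   Context: $\mathbb{Z}_{\max} = \mathbb{Z}\cup\{-\infty\}$ is the tropical integer semiring, with semiring addition $\max$ and semiring multiplication the usual addition; its semiring zero is $-\infty$ and its semiring one is $0$. $M_2(\mathbb{Z}_{\max})$ is the monoid of all $2\times 2$ matrices over $\mathbb{Z}_{\max}$ under (tropical) matrix multiplication. A subset $X$ of a semigroup $\mathcal{S}$ is a generating set if $\mathcal{S}$ is the smallest subsemigroup containing $X$; it is minimal if $|X|\le |Y|$ for every generating set $Y$ of $\mathcal{S}$. ''Minimally generated by $X$'' means $X$ is a minimal generating set. *)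

(* Defs.v *)
From HB Require Import structures.
From mathcomp Require Import all_boot all_order all_algebra.
From mathcomp Require Import mathcomp_extra boolp classical_sets functions.
From mathcomp Require Import cardinality.

Set Implicit Arguments.
Unset Strict Implicit.
Unset Printing Implicit Defensive.

Import Order.TTheory GRing.Theory Num.Theory.
Local Open Scope classical_set_scope.
Local Open Scope ring_scope.

(* The tropical integer semiring.  In ring_scope, [0], [1], [+] and [*] at type
   [Zmax] are the tropical operations, so that [0 = NegInf] and [1 = Fin 0]. *)
Definition Zmax : Type := option int.
Definition Fin (z : int) : Zmax := Some z.
Definition NegInf : Zmax := None.

HB.instance Definition _ := Choice.on Zmax.

Definition Zmax_add (x y : Zmax) : Zmax :=
  match x, y with
  | None, _ => y
  | _, None => x
  | Some a, Some b => Fin (Num.max a b)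
  end.

Definition Zmax_mul (x y : Zmax) : Zmax :=
  match x, y with
  | Some a, Some b => Fin (a + b)
  | _, _ => NegInf
  end.

Fact Zmax_addA : associative Zmax_add.
Proof. by move=> [a|] [b|] [c|] //=; rewrite maxA. Qed.

Fact Zmax_addC : commutative Zmax_add.
Proof. by move=> [a|] [b|] //=; rewrite maxC. Qed.

Fact Zmax_add0 : left_id NegInf Zmax_add.
Proof. by []. Qed.

HB.instance Definition _ :=
  GRing.isNmodule.Build Zmax Zmax_addA Zmax_addC Zmax_add0.

Fact Zmax_mulA : associative Zmax_mul.
Proof. by move=> [a|] [b|] [c|] //=; rewrite addrA. Qed.

Fact Zmax_mulC : commutative Zmax_mul.
Proof. by move=> [a|] [b|] //=; rewrite addrC. Qed.

Fact Zmax_mul1 : left_id (Fin 0) Zmax_mul.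
Proof. by move=> [a|] //=; rewrite add0r. Qed.

Fact Zmax_mulDl : left_distributive Zmax_mul Zmax_add.
Proof. by move=> [a|] [b|] [c|] //=; rewrite addr_maxl. Qed.

Fact Zmax_mul0 : left_zero NegInf Zmax_mul.
Proof. by []. Qed.

Fact Zmax_nonzero : Fin 0 != NegInf.
Proof. by []. Qed.

HB.instance Definition _ := GRing.Nmodule_isComNzSemiRing.Build Zmax
  Zmax_mulA Zmax_mulC Zmax_mul1 Zmax_mulDl Zmax_mul0 Zmax_nonzero.

(* The multiplicative monoid of a semiring.  It is an alias because matrices
   over a finite ring already carry an additive group structure in group_scope. *)
Definition mulmonoid (R : pzSemiRingType) : Type := R.

HB.instance Definition _ (R : pzSemiRingType) := Choice.on (mulmonoid R).
HB.instance Definition _ (R : pzSemiRingType) :=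
  isMonoid.Build (mulmonoid R) (@mulrA R) (@mul1r R) (@mulr1 R).

Definition M2Zmax : monoidType := mulmonoid 'M[Zmax]_2.

Section Generation.
Variable S : semigroupType.
Implicit Types X Y T : set S.

Definition subsemigroup T : Prop :=
  forall x y, T x -> T y -> T (x * y)%g.

Definition generating_set X : Prop := smallest subsemigroup X = setT.

Definition minimal_generating_set X : Prop :=
  generating_set X /\ forall Y, generating_set Y -> (X #<= Y)%card.

End Generation.

Definition mx22 (a b c d : Zmax) : M2Zmax :=
  \matrix_(i < 2, j < 2)
    if i == 0 then (if j == 0 then a else b) else (if j == 0 then c else d).

Definition matA : M2Zmax := mx22 (Fin 1) NegInf
                                 NegInf  (Fin 0).
Definition matB : M2Zmax := mx22 NegInf  (Fin (-1))
                                 (Fin 0) NegInf.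
Definition matC : M2Zmax := mx22 NegInf NegInf
                                 NegInf (Fin 0).
Definition matD : M2Zmax := mx22 (Fin 0) (Fin 0)
                                 NegInf  (Fin 0).

(* Main.v *)
Require Import Defs.
From mathcomp Require Import all_boot all_order all_algebra.
From mathcomp Require Import classical_sets cardinality.
From mathcomp Require Import boolp zify.

(** Generation.  The product [A B] is the permutation matrix of the
    transposition, and [B A B] is the inverse of [A]; with [C] supplying the
    entry -oo, the first three matrices yield every diagonal matrix
    ([generated_diag]).  Rescaling the rows and columns of [D] then gives every
    triangular matrix ([generated_upper], [generated_lower]).  A matrix with
    rows [(a, b)] and [(c, d)] with [d] finite and [b c <= a d] is the product
    of an upper and a lower triangular matrix, because the correction
    [a - b c / d] of the usual elimination becomes [a] when the tropical sum
    absorbs [b c / d]; exchanging the rows turns [b c >= a d] into the case just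
    described.

    Minimality. A tropical product is null only if a factor is, and a tropical
    sum only if both terms are, so the support of a product is the Boolean
    product of the supports ([supp_mul]). Inspecting Boolean matrices, three
    disjoint classes turn out to be unavoidable: a product with a null row or
    column has a factor with one; a product with exactly one null entry has a
    factor with exactly one; a product that is monomial has only monomial
    factors. Hence a generating set meets the first two classes, and its
    monomial members generate all monomial matrices. As [A] and [B] do not
    commute, at least two monomial members are needed, for a total of four. *)

Set Implicit Arguments.
Unset Strict Implicit.
Unset Printing Implicit Defensive.

Import Order.TTheory GRing.Theory Num.Theory.
Local Open Scope ring_scope.
Local Open Scope classical_set_scope.

(** * Generating sets of semigroups *)

Section GeneratingSets.
Variable S : semigroupType.
Implicit Types (X Y T U : set S) (a b x y : S).

Lemma smallest_subsemigroupM X x y :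
  smallest (@subsemigroup S) X x -> smallest (@subsemigroup S) X y ->
  smallest (@subsemigroup S) X (x * y)%g.
Proof.
move=> Xx Xy T TX; case: (TX) => Tsub _.
by apply: Tsub; [apply: Xx | apply: Xy].
Qed.

Lemma generating_set_full Y T :
  generating_set Y -> subsemigroup T -> Y `<=` T -> forall x, T x.
Proof.
move=> genY Tsub YT x.
have : [set: S] x by [].
by rewrite -genY; apply.
Qed.

(** The complement of a prime class is a subsemigroup, and a proper one as soon
    as the class is inhabited. *)
Lemma generating_set_meets_prime Y U a :
    generating_set Y -> (forall x y, U (x * y)%g -> U x \/ U y) -> U a ->
  exists2 y, Y y & U y.
Proof.
move=> genY primeU Ua; apply: contrapT => noU.
have := @generating_set_full Y (~` U) genY _ _ a; apply => //.
- by move=> x y nUx nUy /primeU[].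
- by move=> y Yy Uy; apply: noU; exists y.
Qed.

(** When the complement of [U] is an ideal, elements of [U] are products of
    members of [Y] in [U].  If [u] were the only such member, all of [U] would
    be powers of [u], and any two of its elements would commute. *)
Lemma generating_set_meets_twice Y U a b :
    generating_set Y -> (forall x y, U (x * y)%g -> U x /\ U y) ->
    U a -> U b -> (a * b)%g <> (b * a)%g ->
  exists u v, [/\ Y u, Y v, U u, U v & u <> v].
Proof.
move=> genY filterU Ua Ub ab_neq.
have [|u Yu Uu] := generating_set_meets_prime genY _ Ua.
  by move=> x y /filterU[]; left.
apply: contrapT => only_u.
have Y_U_u y : Y y -> U y -> y = u.
  move=> Yy Uy; apply: contrapT => y_neq_u; apply: only_u.
  by exists y, u.
(* If the members of [Y] in [U] commute with [c], so does all of [U]. *)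
have commute_with c : (u * c)%g = (c * u)%g ->
    forall x, U x -> (x * c)%g = (c * x)%g.
  move=> uc; apply: (@generating_set_full Y) => //.
    move=> x y xc yc /filterU[/xc {}xc /yc {}yc].
    by rewrite -mulgA yc mulgA xc mulgA.
  by move=> y Yy /(Y_U_u _ Yy) ->.
(* Taking [c = u] shows that [a] commutes with [u]; then [c = a] is allowed. *)
have au : (a * u)%g = (u * a)%g by apply: commute_with.
by apply/ab_neq/esym; apply: commute_with.
Qed.

End GeneratingSets.

(** * Matrices by entries *)

Local Arguments mx22 (a b c d)%_ring_scope.

Lemma mx22_eta (M : M2Zmax) : M = mx22 (M 0 0) (M 0 1) (M 1 0) (M 1 1).
Proof.
apply/matrixP => i j; rewrite mxE.
by case: i j => [[|[|]] // ?] [[|[|]] // ?]; congr (M _ _); apply/val_inj.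
Qed.

Lemma mul_mx22E (M N : M2Zmax) (i j : 'I_2) :
  (M * N)%g i j = M i 0 * N 0 j + M i 1 * N 1 j.
Proof.
rewrite [(M * N)%g]/(M *m N) mxE !big_ord_recl big_ord0 addr0.
by congr (_ + M i _ * N _ j); apply/val_inj.
Qed.

Lemma mul_mx22 (a b c d a' b' c' d' : Zmax) :
  (mx22 a b c d * mx22 a' b' c' d')%g =
  mx22 (a * a' + b * c') (a * b' + b * d') (c * a' + d * c') (c * b' + d * d').
Proof.
by rewrite [LHS]mx22_eta !mul_mx22E !mxE /=.
Qed.

(** * The four matrices generate *)

Local Notation generated :=
  (smallest (@subsemigroup M2Zmax) [set matA; matB; matC; matD]).

Local Notation swap := (mx22 0 1 1 0).

Local Definition tropE := (mul_mx22, mul0r, mulr0, mul1r, mulr1, add0r, addr0).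

Lemma generatedA : generated matA.
Proof. by apply: sub_gen_smallest; left; left; left. Qed.

Lemma generatedB : generated matB.
Proof. by apply: sub_gen_smallest; left; left; right. Qed.

Lemma generatedC : generated matC.
Proof. by apply: sub_gen_smallest; left; right. Qed.

Lemma generatedD : generated matD.
Proof. by apply: sub_gen_smallest; right. Qed.

Lemma generated_swap : generated swap.
Proof.
have -> : swap = (matA * matB)%g by rewrite !tropE.
exact: smallest_subsemigroupM generatedA generatedB.
Qed.

Lemma generated_swap_rows a b c d :
  generated (mx22 c d a b) -> generated (mx22 a b c d).
Proof.
move=> /(smallest_subsemigroupM generated_swap).
by rewrite !tropE.
Qed.

Lemma generated_swap_cols a b c d :
  generated (mx22 b a d c) -> generated (mx22 a b c d).
Proof.
move=> /smallest_subsemigroupM /(_ generated_swap).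
by rewrite !tropE.
Qed.

Lemma generated_diag1 a : generated (mx22 a 0 0 1).
Proof.
case: a => [z|]; last exact: generatedC.
elim/int_ind: z => [|n IHn|n IHn].
- apply: generated_swap_rows; exact: generated_swap.
- have -> : mx22 (Some n.+1%:Z) 0 0 1 = (matA * mx22 (Some n%:Z) 0 0 1)%g.
    by rewrite !tropE; congr (mx22 (Some _)); lia.
  exact: smallest_subsemigroupM generatedA IHn.
- (* [B * swap = B A B] is the inverse of [A]. *)
  have -> : mx22 (Some (- n.+1%:Z)) 0 0 1 =
      ((matB * swap) * mx22 (Some (- n%:Z)) 0 0 1)%g.
    by rewrite !tropE; congr (mx22 (Some _)); lia.
  apply: smallest_subsemigroupM IHn.
  exact: smallest_subsemigroupM generatedB generated_swap.
Qed.

Lemma generated_diag a d : generated (mx22 a 0 0 d).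
Proof.
have -> : mx22 a 0 0 d = (mx22 a 0 0 1 * mx22 1 0 0 d)%g by rewrite !tropE.
apply: smallest_subsemigroupM; first exact: generated_diag1.
apply: generated_swap_rows; apply: generated_swap_cols.
exact: generated_diag1.
Qed.

(** Rescaling rows by [(b, d)] and columns by [(a / b, 1)] turns [D] into any
    upper triangular matrix with [b] finite; [a] and [d] may be -oo. *)
Lemma generated_upper a b d : generated (mx22 a b 0 d).
Proof.
case: b => [b|]; last exact: generated_diag.
have -> : mx22 a (Fin b) 0 d =
    (mx22 (Fin b) 0 0 d * matD * mx22 (Fin (- b) * a)%R 0 0 1)%g.
  rewrite !tropE; congr mx22.
  by rewrite mulrA [X in X * a](_ : _ = 1) ?mul1r//; congr Some; lia.
apply: smallest_subsemigroupM; last exact: generated_diag.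
apply: smallest_subsemigroupM generatedD; exact: generated_diag.
Qed.

Lemma generated_lower a c d : generated (mx22 a 0 c d).
Proof.
apply: generated_swap_rows; apply: generated_swap_cols.
exact: generated_upper.
Qed.

(** The condition says that [a d] dominates [b c], so that adding
    [(b / d) c] to [a] leaves [a] unchanged. *)
Lemma generated_UL (a b c d : int) : b + c <= a + d ->
  generated (mx22 (Fin a) (Fin b) (Fin c) (Fin d)).
Proof.
move=> bc_le_ad.
have -> : mx22 (Fin a) (Fin b) (Fin c) (Fin d) =
    (mx22 1 (Fin (b - d)) 0 1 * mx22 (Fin a) 0 (Fin c) (Fin d))%g.
  by rewrite !tropE; congr mx22; congr Some; lia.
exact: smallest_subsemigroupM (generated_upper _ _ _) (generated_lower _ _ _).
Qed.

Lemma generated_mx22 a b c d : generated (mx22 a b c d).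
Proof.
case: c => [c|]; last exact: generated_upper.
case: b => [b|]; last exact: generated_lower.
case: a => [a|]; last by apply: generated_swap_rows; exact: generated_upper.
case: d => [d|]; last by apply: generated_swap_rows; exact: generated_lower.
have [|/ltW] := leP (b + c) (a + d); first exact: generated_UL.
move=> ad_le_bc; apply: generated_swap_rows; apply: generated_UL.
by lia.
Qed.

Lemma generating_set_ABCD : generating_set [set matA; matB; matC; matD].
Proof.
by apply/seteqP; split=> // M _; rewrite [M]mx22_eta; apply: generated_mx22.
Qed.

(** * Supports *)

Definition supp (M : M2Zmax) (i j : 'I_2) : bool := M i j != 0.
Local Arguments supp M (i j)%_ring_scope.

Lemma supp_mul (M N : M2Zmax) i j :
  supp (M * N)%g i j = supp M i 0 && supp N 0 j || supp M i 1 && supp N 1 j.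
Proof.
rewrite /supp mul_mx22E.
by case: (M i 0) (M i 1) (N 0 j) (N 1 j) => [?|] [?|] [?|] [?|].
Qed.

Definition has_null_line (M : M2Zmax) : Prop :=
  ~~ [&& supp M 0 0 || supp M 0 1, supp M 1 0 || supp M 1 1,
         supp M 0 0 || supp M 1 0 & supp M 0 1 || supp M 1 1].

Definition has_one_null_entry (M : M2Zmax) : Prop :=
  (supp M 0 0 + supp M 0 1 + supp M 1 0 + supp M 1 1 = 3)%N.

Definition monomial (M : M2Zmax) : Prop :=
  [&& supp M 0 0 == supp M 1 1, supp M 0 1 == supp M 1 0
    & supp M 0 0 != supp M 0 1].

(** These three facts concern Boolean matrices only, of which there are
    sixteen. *)
Lemma has_null_line_prime (M N : M2Zmax) :
  has_null_line (M * N)%g -> has_null_line M \/ has_null_line N.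
Proof.
rewrite /has_null_line !supp_mul.
case: (supp M 0 0) (supp M 0 1) (supp M 1 0) (supp M 1 1) => [] [] [] [];
case: (supp N 0 0) (supp N 0 1) (supp N 1 0) (supp N 1 1) => [] [] [] [] //=;
by [left | right].
Qed.

Lemma has_one_null_entry_prime (M N : M2Zmax) :
  has_one_null_entry (M * N)%g -> has_one_null_entry M \/ has_one_null_entry N.
Proof.
rewrite /has_one_null_entry !supp_mul.
case: (supp M 0 0) (supp M 0 1) (supp M 1 0) (supp M 1 1) => [] [] [] [];
case: (supp N 0 0) (supp N 0 1) (supp N 1 0) (supp N 1 1) => [] [] [] [] //=;
by [left | right].
Qed.

Lemma monomial_filter (M N : M2Zmax) :
  monomial (M * N)%g -> monomial M /\ monomial N.
Proof.
rewrite /monomial !supp_mul.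
case: (supp M 0 0) (supp M 0 1) (supp M 1 0) (supp M 1 1) => [] [] [] [];
by case: (supp N 0 0) (supp N 0 1) (supp N 1 0) (supp N 1 1) => [] [] [] [].
Qed.

Lemma monomial_not_null_line M : monomial M -> ~ has_null_line M.
Proof.
rewrite /monomial /has_null_line.
by case: (supp M 0 0) (supp M 0 1) (supp M 1 0) (supp M 1 1) => [] [] [] [].
Qed.

Lemma one_null_entry_not_null_line M :
  has_one_null_entry M -> ~ has_null_line M.
Proof.
rewrite /has_one_null_entry /has_null_line.
by case: (supp M 0 0) (supp M 0 1) (supp M 1 0) (supp M 1 1) => [] [] [] [].
Qed.

Lemma one_null_entry_not_monomial M : has_one_null_entry M -> ~ monomial M.
Proof.
rewrite /has_one_null_entry /monomial.
by case: (supp M 0 0) (supp M 0 1) (supp M 1 0) (supp M 1 1) => [] [] [] [].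
Qed.

(** * Lower bound on generating sets *)

Lemma matAB_not_commute : (matA * matB)%g <> (matB * matA)%g.
Proof.
by rewrite !mul_mx22 => /matrixP/(_ 0 1); rewrite !mxE.
Qed.

Lemma card_le4 (T : choiceType) (Y : set T) (a b c d : T) (u v w x : T) :
    Y u -> Y v -> Y w -> Y x -> uniq [:: u; v; w; x] ->
  ([set a; b; c; d] #<= Y)%card.
Proof.
move=> Yu Yv Yw Yx; rewrite /= !inE !negb_or.
case/and4P=> /and3P[uv uw ux] /andP[vw vx] wx _.
pose f y := if y == u then a else if y == v then b else
            if y == w then c else d.
apply: card_le_trans (card_image_le f Y); apply: subset_card_le.
move=> _ [[[->|->]|->]|->].
- by exists u; rewrite // /f eqxx.
- by exists v; rewrite // /f eqxx eq_sym (negbTE uv).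
- by exists w; rewrite // /f eqxx eq_sym (negbTE uw) eq_sym (negbTE vw).
- exists x; rewrite // /f eq_sym (negbTE ux) eq_sym (negbTE vx).
  by rewrite eq_sym (negbTE wx).
Qed.

Theorem corollary4p4 :
  minimal_generating_set [set matA; matB; matC; matD].
Proof.
split; first exact: generating_set_ABCD.
move=> Y genY.
have monomialA : monomial matA by rewrite /monomial /supp !mxE.
have monomialB : monomial matB by rewrite /monomial /supp !mxE.
have null_lineC : has_null_line matC by rewrite /has_null_line /supp !mxE.
have one_nullD : has_one_null_entry matD.
  by rewrite /has_one_null_entry /supp !mxE.
have [u [v [Yu Yv Uu Uv /eqP uv]]] := generating_set_meets_twice genY
  monomial_filter monomialA monomialB matAB_not_commute.
have [w Yw Zw] :=
  generating_set_meets_prime genY has_null_line_prime null_lineC.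
have [x Yx Ox] :=
  generating_set_meets_prime genY has_one_null_entry_prime one_nullD.
apply: (card_le4 _ _ _ _ Yu Yv Yw Yx).
have neq_of (P : M2Zmax -> Prop) M N : P M -> ~ P N -> M != N.
  by move=> PM nPN; apply/eqP => MN; apply: nPN; rewrite -MN.
rewrite /= !inE !negb_or uv /=.
have nUx := one_null_entry_not_monomial Ox.
have nZu := monomial_not_null_line Uu.
have nZv := monomial_not_null_line Uv.
have nZx := one_null_entry_not_null_line Ox.
rewrite (neq_of _ _ _ Uu nUx) (neq_of _ _ _ Uv nUx) (neq_of _ _ _ Zw nZx).
by rewrite 2!(eq_sym _ w) (neq_of _ _ _ Zw nZu) (neq_of _ _ _ Zw nZv).
Qed.
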